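(* Let $(V,d,\mu)$ be an isoperimetric probability metric space, let $\mathcal{F}$ be the class of all $\mu$-integrable $1$-Lipschitz functions $f:V\to\mathbb{R}$, and put $$D(x)=\sup_{f\in \mathcal{F}}\mu\{u\in V: f(u)-\mathbf{E}_{\mu} f\geq x\},\qquad x\in\mathbb{R}.$$ Then for every $x\in\mathbb{R}$ there is an extremal set $A_{\mathrm{opt}}\subset V$ such that, with $f^{\ast}(u)=-d(A_{\mathrm{opt}},u)$, $$D(x)=\mu\{u\in V: f^{\ast}(u)-\mathbf{E}_{\mu} f^{\ast}\geq x\},$$ and moreover $\mu(A_{\mathrm{opt}})=D(x)$.
   Context: A probability metric space $(V,d,\mu)$ is a metric space $(V,d)$ with a Borel measure $\mu$ normalized so that $\mu(V)=1$. A function $f:V\to\mathbb{R}$ is $1$-Lipschitz if $|f(u)-f(v)|\leq d(u,v)$ for all $u,v\in V$. $\mathbf{E}_{\mu} f=\int_V f\,d\mu$. For $A\subset V$ and $u\in V$, $d(A,u)=d(u,A)=\inf_{a\in A} d(a,u)$, and for $h\geq 0$ the $h$-enlargement of $A$ is $A^h=\{u\in V: d(u,A)\leq h\}$. Vertex isoperimetric problem: given $t\in[0,1]$ and $h\geq 0$, minimize $\mu(A^h)$ over all measurable $A\subset V$ with $\mu(A)\geq t$. A measurable set $A_{\mathrm{opt}}$ is called extremal (for $t$) if $\mu(A_{\mathrm{opt}})\geq t$ and it solves this problem simultaneously for all $h\geq 0$, that is, $\mu(A_{\mathrm{opt}}^h)\leq \mu(A^h)$ for every $h\geq 0$ and every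 measurable $A\subset V$ with $\mu(A)\geq t$. The space $(V,d,\mu)$ is called isoperimetric if for every $t\in[0,1]$ an extremal set for $t$ exists (i.e. a solution not depending on $h$). An extremal set means a set that is extremal for some $t$. *)

(* Defs.v *)
From HB Require Import structures.
From mathcomp Require Import all_boot all_order all_algebra.
From mathcomp Require Import all_classical all_reals all_analysis.

Set Implicit Arguments.
Unset Strict Implicit.
Unset Printing Implicit Defensive.

Import Order.TTheory GRing.Theory Num.Theory.

Local Open Scope classical_set_scope.
Local Open Scope ring_scope.

(* Metric spaces with a chosen point: [g_sigma_algebraType] asks for a pointed
   carrier.  No generality is lost, as a space carrying a probability measure
   is nonempty. *)
#[short(type="pmetricType")]
HB.structure Definition PointedMetric (K : numDomainType) :=
  {M of Metric K M & Pointed M}.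

Notation borel V := (g_sigma_algebraType (@open V)).

Section definitions.
Context {R : realType} {V : pmetricType R}.
Variable P : probability (borel V) R.
Implicit Types (A B : set V) (u v : V) (t h x : R).

(* The infimum is taken in the extended reals, so that the distance to the
   empty set is [+oo] and every enlargement of the empty set is empty. *)
Definition setdist A u : \bar R := ereal_inf [set (mdist a u)%:E | a in A].

Definition enlargement A h : set V := [set u | (setdist A u <= h%:E)%E].

Definition lipschitz1 (f : V -> R) : Prop :=
  forall u v, `|f u - f v| <= mdist u v.

Definition extremal_for t A : Prop :=
  [/\ measurable (A : set (borel V)), (t%:E <= P A)%E &
    forall h B, 0 <= h -> measurable (B : set (borel V)) -> (t%:E <= P B)%E ->
      (P (enlargement A h) <= P (enlargement B h))%E].

Definition extremal A : Prop := exists2 t, 0 <= t <= 1 & extremal_for t A.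

Definition isoperimetric : Prop :=
  forall t, 0 <= t <= 1 -> exists A, extremal_for t A.

(* [f] is extended-real-valued to accommodate [f u = - setdist A u]; this is
   finite unless [A] is empty.  For [A] empty, [f] and its integral are [-oo],
   and [-oo - -oo = -oo] in [\bar R], so the event is empty. *)
Definition deviation (f : V -> \bar R) x : \bar R :=
  P [set u | (x%:E <= f u - \int[P]_v f v)%E].

Definition lipschitz_class : set (V -> R) :=
  [set f | P.-integrable [set: borel V] (EFin \o f) /\ lipschitz1 f].

Definition sup_deviation x : \bar R :=
  ereal_sup [set deviation (EFin \o f) x | f in lipschitz_class].

End definitions.

(* Main.v *)
Require Import Defs.
From mathcomp Require Import all_boot all_order all_algebra.
From mathcomp Require Import all_classical all_reals all_analysis.
From mathcomp Require Import measurable_realfun lra.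

Set Implicit Arguments.
Unset Strict Implicit.
Unset Printing Implicit Defensive.

Import Order.TTheory GRing.Theory Num.Theory.
Import numFieldNormedType.Exports.

Local Open Scope classical_set_scope.
Local Open Scope ring_scope.

(** Write [d_A] for the distance to [A] and [E] for the mean.

    Among nonempty sets of measure at least [t > 0], an extremal set [A] has the
    smallest enlargements, so [d_A] has the heaviest tails and hence the
    largest mean ([extremal_mean_ge]).  If [f] is 1-Lipschitz and [B] is the
    nonempty event [f - E f >= x], then [f >= E f + x - d_B] everywhere, and
    taking means gives [E d_B >= x] ([superlevel_mean]).  So an extremal set [A]
    for [t = P B] satisfies [E d_A >= x], which says that the event
    [- d_A + E d_A >= x] contains [A].  The deviation of [- d_A] is then at least
    [P A], which is at least [P B].

    It remains to treat [D x] itself, which is only a supremum.  Assume that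
    [T = D x] is positive, and let [A] be extremal for [T].  If [E d_A >= x], then
    [T <= P A <= deviation of - d_A <= D x = T], and all is proved.  Two points
    need an argument.

    - The mean of [d_A] must pass to the limit along [t_n] increasing to [T]
      ([extremal_mean_lim]).  No compactness of the space is available; the
      substitute is a duality.  If [B_n] is extremal for [t_n], and [C_n] is the
      complement of its [r]-enlargement, then the smaller enlargements of [C_n]
      avoid [B_n].  A set [C] extremal for [s = inf P C_n] therefore has
      enlargements of measure at most [1 - t_n] for every [n], so at most
      [1 - T].  Passing to complements again produces a set of measure at
      least [T] whose enlargements have measure at most [1 - s], and [A] does
      at least as well ([extremal_tail_lim]).  The tail of [d_A] thus dominates
      the limit of the tails of [d_(B_n)], and dominated convergence in the
      formula [E f = int_0^oo P (f > r) dr] concludes.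

    - The function [- d_A] must be integrable, and no integrability of the metric
      is assumed.  It is a consequence of isoperimetry ([mdist_integrable]).
      Let [o] be a point and [K] a ball of radius [r] around [o] of measure
      above one half, and let [A] be extremal for the measure of
      [d(o, -) >= n].  That event spares [K] when enlarged by less than [n - r], so
      [A] lies within [d(o, -) >= n - 2 r]; on the other hand, [A] has a point
      within [n] of [o], hence its [2 n]-enlargement covers the ball of radius
      [n].  Compared with the [2 n]-enlargement of [K], this yields
      [P (d(o, -) > 2 n + r) <=
        P (d(o, -) >= n - 2 r) - P (d(o, -) >= n)] ([tail_decrement]).  The
      right-hand sides telescope along [n = 2 r k], so the tails are summable.

    When [D x = 0] the empty set works. *)

(** * Distances to a set *)

Section set_distance.
Context {R : realType} {V : pmetricType R}.
Implicit Types (A B : set V) (a u v : V) (h r : R).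

(** For nonempty [A] this is the distance as a real number; for empty [A] it is
    the junk value [0]. *)
Definition rdist A u : R := fine (setdist A u).

Lemma setdist_ge0 A u : (0 <= setdist A u)%E.
Proof.
by apply: le_ereal_inf_tmp => _ [a _ <-]; rewrite lee_fin mdist_ge0.
Qed.

Lemma setdist_le A a u : A a -> (setdist A u <= (mdist a u)%:E)%E.
Proof. by move=> Aa; apply: ereal_inf_lbound; exists a. Qed.

Lemma setdistE A a u : A a -> setdist A u = (rdist A u)%:E.
Proof.
move=> Aa; rewrite fineK// ge0_fin_numE ?setdist_ge0//.
by rewrite (le_lt_trans (setdist_le u Aa))// ltry.
Qed.

Lemma rdist_ge0 A u : 0 <= rdist A u.
Proof. by rewrite fine_ge0// setdist_ge0. Qed.

Lemma rdist_le A a u : A a -> rdist A u <= mdist a u.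
Proof. by move=> Aa; rewrite -lee_fin -(setdistE u Aa) setdist_le. Qed.

Lemma le_rdist A r u : A !=set0 -> (forall a, A a -> r <= mdist a u) ->
  r <= rdist A u.
Proof.
move=> [a0 Aa0] rA; rewrite -lee_fin -(setdistE u Aa0).
by apply: le_ereal_inf_tmp => _ [a Aa <-]; rewrite lee_fin rA.
Qed.

Lemma rdist0 A u : A u -> rdist A u = 0.
Proof.
by move=> Au; apply/eqP; rewrite eq_le rdist_ge0 andbT -(mdistxx u) rdist_le.
Qed.

Lemma rdist_lipschitz A : A !=set0 -> lipschitz1 (rdist A).
Proof.
move=> A0; suff le u v : rdist A u <= rdist A v + mdist u v.
  move=> u v; have := le u v; have := le v u; rewrite (metric_sym v u) => h1 h2.
  by rewrite ler_norml; apply/andP; split; lra.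
rewrite -lerBlDr; apply: le_rdist => // a Aa; rewrite lerBlDr.
by rewrite (le_trans (rdist_le u Aa))// (metric_sym u v) metric_triangle.
Qed.

Lemma mdist_lipschitz u : lipschitz1 (mdist u).
Proof.
move=> v w; have := metric_triangle u v w; have := metric_triangle u w v.
by rewrite (metric_sym w v) ler_norml => h1 h2; apply/andP; split; lra.
Qed.

Lemma lipschitz_measurable (f : V -> R) : lipschitz1 f ->
  measurable_fun [set: borel V] f.
Proof.
move=> lf; apply: (measurability _ (RGenOInfty.measurableE R)).
move=> _ [_ [x ->] <-]; rewrite setTI; apply: sub_sigma_algebra.
rewrite openE => u /=; rewrite in_itv/= andbT => xu.
rewrite /interior; apply/nbhs_ballP; exists (f u - x) => /=; first by rewrite subr_gt0.
move=> v; rewrite ballEmdist/= in_itv/= andbT => uv.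
by have := lf u v; rewrite ler_norml => /andP[h1 h2]; lra.
Qed.

Lemma enlargement0 h : enlargement (set0 : set V) h = set0.
Proof.
by apply/seteqP; split => // u /=; rewrite /enlargement/= /setdist image_set0 ereal_inf0.
Qed.

Lemma enlargementE A h : A !=set0 -> enlargement A h = [set u | rdist A u <= h].
Proof.
by move=> [a Aa]; apply/seteqP; split => u; rewrite /enlargement/= (setdistE u Aa) lee_fin.
Qed.

Lemma enlargement_sub A a u h : A a -> mdist a u <= h -> enlargement A h u.
Proof. by move=> Aa auh; apply: (le_trans (setdist_le u Aa)); rewrite lee_fin. Qed.

Lemma measurable_sublevel (f : V -> R) r : lipschitz1 f ->
  measurable ([set u | f u <= r] : set (borel V)).
Proof.
move=> /lipschitz_measurable/(_ measurableT `]-oo, r]%classic).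
rewrite setTI => /(_ (measurable_itv _)).
by congr measurable; apply/seteqP; split => u /=; rewrite in_itv.
Qed.

Lemma measurable_suplevel (f : V -> R) r : lipschitz1 f ->
  measurable ([set u | r < f u] : set (borel V)).
Proof.
move=> lf; rewrite (_ : [set _ | _] = ~` [set u | f u <= r]).
  by apply: measurableC; exact: measurable_sublevel.
by apply/seteqP; split => u /=; rewrite ltNge => /negP.
Qed.

Lemma measurable_suplevel_weak (f : V -> R) r : lipschitz1 f ->
  measurable ([set u | r <= f u] : set (borel V)).
Proof.
move=> lf; rewrite (_ : [set _ | _] = [set u | (- f u) <= (- r)]).
  by apply: measurable_sublevel => u v; rewrite -opprD normrN lf.
by apply/seteqP; split => u /=; rewrite lerN2.
Qed.

Lemma measurable_enlargement A h : measurable (enlargement A h : set (borel V)).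
Proof.
have [->|/set0P A0] := eqVneq A set0; first by rewrite enlargement0.
by rewrite enlargementE//; by apply: measurable_sublevel; exact: rdist_lipschitz.
Qed.

Lemma measurable_enlargementC A h :
  measurable (~` enlargement A h : set (borel V)).
Proof. by apply: measurableC; exact: measurable_enlargement. Qed.

(** The duality between a set and the complement of its enlargement: points of
    the complement are farther than [r] from [A]. *)
Lemma enlargement_setC A r h : h < r ->
  enlargement (~` enlargement A r) h `<=` ~` A.
Proof.
move=> hr u + Au; apply/negP; rewrite -ltNge.
apply: (@lt_le_trans _ _ r%:E); first by rewrite lte_fin.
apply: le_ereal_inf_tmp => _ [c /negP Ac <-]; rewrite lee_fin.
rewrite -ltNge in Ac; rewrite -lee_fin metric_sym.
exact: (le_trans (ltW Ac) (setdist_le c Au)).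
Qed.

End set_distance.

(** * Expectations and tails *)

Section tails.
Context d {T : measurableType d} {R : realType} (P : probability T R).
Implicit Types f g : T -> R.
Local Notation mu := (@lebesgue_measure R).

Lemma ge0_integral_tail f : measurable_fun setT f -> (forall x, 0 <= f x) ->
  (\int[P]_x (f x)%:E = \int[mu]_(r in `[0%R, +oo[) P [set x | (r < f x)%R])%E.
Proof.
move=> mf f0.
pose X : {RV P >-> R} := mfun_Sub (mem_set mf).
have := @ge0_expectation_ccdf _ _ _ P X f0; rewrite expectation_def => ->.
apply: eq_integral => r _; rewrite /ccdf /distribution /pushforward.
by congr (P _); apply/seteqP; split => x /=; rewrite in_itv/= andbT.
Qed.

Lemma measurable_tail f : measurable_fun setT f ->
  measurable_fun [set: R] (fun r : R => P [set x | (r < f x)%R]).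
Proof.
move=> mf; pose X : {RV P >-> R} := mfun_Sub (mem_set mf).
apply: (eq_measurable_fun (ccdf X)) (ccdf_measurable X) => r _.
rewrite /ccdf /distribution /pushforward.
by congr (P _); apply/seteqP; split => x /=; rewrite in_itv/= andbT.
Qed.

Lemma le_integral_tail f g : measurable_fun setT f -> measurable_fun setT g ->
  (forall x, 0 <= f x) -> (forall x, 0 <= g x) ->
  (forall r, 0 <= r -> (P [set x | (r < f x)%R] <= P [set x | (r < g x)%R])%E) ->
  (\int[P]_x (f x)%:E <= \int[P]_x (g x)%:E)%E.
Proof.
move=> mf mg f0 g0 fg; rewrite !ge0_integral_tail//; apply: ge0_le_integral => //.
- by apply: measurable_funTS; exact: measurable_tail.
- by apply: measurable_funTS; exact: measurable_tail.
- by move=> r; rewrite /= in_itv/= andbT; exact: fg.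
Qed.

Lemma measurable_gt f r : measurable_fun setT f -> measurable [set x | r < f x].
Proof.
move=> mf; have := mf measurableT _ (measurable_itv `]r, +oo[); rewrite setTI.
by congr measurable; apply/seteqP; split => x /=; rewrite in_itv/= andbT.
Qed.

(** The means are integrals of the tails over the half-line; there the tails of
    [f n] decrease to their infimum, dominated by the integrable tail of [f 0].
    The tail of [g] is compared with that infimum through its lower bounds [s],
    which is the form in which [extremal_tail_lim] delivers the comparison. *)
Lemma ge_integral_tail_lim (f : nat -> T -> R) g (x : \bar R) :
  (forall n, measurable_fun setT (f n)) -> measurable_fun setT g ->
  (forall n u, 0 <= f n u) -> (forall u, 0 <= g u) ->
  (\int[P]_u (f 0%N u)%:E < +oo)%E ->
  (forall n r, 0 <= r ->
    (P [set u | (r < f n.+1 u)%R] <= P [set u | (r < f n u)%R])%E) ->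
  (forall s r, 0 <= r -> (forall n, (s <= P [set u | (r < f n u)%R])%E) ->
    (s <= P [set u | (r < g u)%R])%E) ->
  (forall n, (x <= \int[P]_u (f n u)%:E)%E) -> (x <= \int[P]_u (g u)%:E)%E.
Proof.
move=> mf mg f0 g0 fi fS fg xf.
pose c n r := P [set u | (r < f n u)%R].
have cn n m r : 0 <= r -> (n <= m)%N -> (c m r <= c n r)%E.
  move=> r0; elim: m => [|m IH]; first by rewrite leqn0 => /eqP->.
  rewrite leq_eqVlt => /predU1P[->//|/IH]; apply: le_trans; exact: fS.
pose l r := ereal_inf (range (c ^~ r)).
have mD : measurable (`[0, +oo[ : set R) by [].
have mc n : measurable_fun (`[0, +oo[ : set R) (c n).
  by apply: measurable_funTS; exact: measurable_tail.
have cl r : `[0, +oo[%classic r -> c ^~ r @ \oo --> l r.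
  rewrite /= in_itv/= andbT => r0; apply: ereal_nonincreasing_cvgn => n m.
  exact: cn.
have ml : measurable_fun (`[0, +oo[ : set R) l.
  exact: (emeasurable_fun_cvg _ _ mc cl).
have ic0 : mu.-integrable `[0, +oo[ (c 0%N).
  apply/integrableP; split; first exact: mc.
  move: fi; rewrite ge0_integral_tail//.
  by congr (_ < _)%E; apply: eq_integral => r _; rewrite gee0_abs.
have [||_ _ lim] := @dominated_convergence _ _ _ mu _ mD c l (c 0%N) mc ml _ ic0.
- exact: aeW.
- apply: aeW => r n; rewrite /= in_itv/= andbT => r0.
  by rewrite gee0_abs//; exact: cn.
apply: (@le_trans _ _ (\int[mu]_(r in `[0%R, +oo[) l r)%E).
  rewrite -(cvg_lim _ lim)//.
  apply: lime_ge; first by apply: cvgP lim.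
  by apply: nearW => n /=; have := xf n; rewrite ge0_integral_tail.
rewrite ge0_integral_tail//; apply: ge0_le_integral => //.
- by move=> r _; apply: le_ereal_inf_tmp => _ [n _ <-].
- by apply: measurable_funTS; exact: measurable_tail.
- move=> r; rewrite /= in_itv/= andbT => r0; apply: fg => // n.
  by apply: ereal_inf_lbound; exists n.
Qed.

End tails.
(** Measures of events are converted to real numbers, [pr A], so that linear
    arithmetic applies to them. *)
Section probability_reals.
Context d {T : measurableType d} {R : realType} (P : probability T R).
Local Notation pr A := (fine (P A)).

Lemma prE (A : set T) : measurable A -> P A = (pr A)%:E.
Proof. by move=> mA; rewrite fineK// fin_num_measure. Qed.

Lemma pr_ge0 (A : set T) : 0 <= pr A.
Proof. exact: fine_ge0. Qed.

Lemma pr_le1 (A : set T) : measurable A -> pr A <= 1.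
Proof. by move=> mA; rewrite -lee_fin -prE// probability_le1. Qed.

Lemma pr_le (A B : set T) : measurable A -> measurable B -> A `<=` B -> pr A <= pr B.
Proof. by move=> mA mB AB; rewrite -lee_fin -!prE// le_measure ?inE. Qed.

Lemma prC (A : set T) : measurable A -> pr (~` A) = 1 - pr A.
Proof.
move=> mA; apply: EFin_inj; rewrite EFinB -!prE//; first exact: probability_setC.
exact: measurableC.
Qed.

Lemma prD (A B : set T) : measurable A -> measurable B -> B `<=` A ->
  pr (A `\` B) = pr A - pr B.
Proof.
move=> mA mB BA; apply: EFin_inj; rewrite EFinB -!prE//; last exact: measurableD.
rewrite measureD//; last by rewrite (le_lt_trans (probability_le1 P mA))// ltry.
by rewrite setIidr.
Qed.

(** The staircase with steps of height [L] placed at the points [L * k.+1 + r]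
    lies within [L + r] of [f], so the mean of [f] is controlled by the sum of
    the tails at these points. *)
Lemma integrable_sum_tail (f : T -> R) (L r C : R) :
  measurable_fun setT f -> (forall u, 0 <= f u) -> 0 < L -> 0 <= r ->
  (forall m, \sum_(k < m) pr [set u | L * k.+1%:R + r < f u] <= C) ->
  P.-integrable setT (EFin \o f).
Proof.
move=> mf f0 L0 r0 sC; apply/integrableP; split; first exact/measurable_EFinP.
pose S k := [set u | L * k.+1%:R + r < f u].
have mS k : measurable (S k) by exact: measurable_gt.
pose g u : \bar R := (\sum_(k <oo) (\1_(S k) u)%:E)%E.
have g0 u : (0 <= g u)%E by apply: nneseries_ge0.
have m1 k : measurable_fun setT (fun u => (\1_(S k) u)%:E : \bar R).
  by apply/measurable_EFinP; exact: measurable_indic.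
have mg : measurable_fun setT g.
  by apply: ge0_emeasurable_sum => // k u _ _; rewrite lee_fin.
have stairs u m : Num.min (f u) (L * m.+1%:R + r) <=
    L + r + L * \sum_(k < m) (\1_(S k) u : R).
  (* The last step contributes only beyond [L * m.+1 + r], where all the lower
     steps are already climbed and the minimum equals that threshold. *)
  elim: m => [|m]; first by rewrite big_ord0 mulr0 addr0 mulr1 ge_min lexx orbT.
  rewrite big_ord_recr/=; set s := \sum_(k < m) _ => IH.
  rewrite [L * (s + _)]mulrDr.
  have Lm : L * m.+2%:R = L * m.+1%:R + L by rewrite -(natr1 m.+1) mulrDr mulr1.
  have [uS|uS] := ltP (L * m.+1%:R + r) (f u).
    rewrite indicE mem_set//= mulr1 ge_min; apply/orP; right.
    by move: IH; rewrite (min_idPr (ltW uS)); lra.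
  have : 0 <= L * (\1_(S m) u : R) by rewrite mulr_ge0// ltW.
  move: IH; rewrite (min_idPl uS) ge_min => IH p0; apply/orP; left; lra.
have fg u : ((f u)%:E <= (L + r)%:E + L%:E * g u)%E.
  have [m fm] : exists m, f u <= L * m.+1%:R + r.
    exists (Num.bound (f u / L)); rewrite -lerBlDr -ler_pdivrMl// mulrC.
    rewrite (@le_trans _ _ (f u / L))//.
      by rewrite ler_wpM2r ?invr_ge0 ?(ltW L0)// lerBlDr lerDl.
    apply/ltW/(lt_le_trans (archi_boundP _)); first by rewrite divr_ge0// ltW.
    by rewrite ler_nat.
  have := stairs u m; rewrite (min_idPl fm) -lee_fin => /le_trans; apply.
  rewrite EFinD leeD2l// EFinM lee_pmul2l// -sumEFin -(big_mkord xpredT (fun k => (\1_(S k) u)%:E)).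
  exact: nneseries_lim_ge.
apply: (@le_lt_trans _ _ (\int[P]_u ((L + r)%:E + L%:E * g u))%E).
  apply: ge0_le_integral => //.
  - by do 2 apply: measurableT_comp => //; exact/measurable_EFinP.
  - by apply: emeasurable_funD => //; exact: measurable_funeM.
  - by move=> u _ /=; rewrite ger0_norm.
rewrite ge0_integralD//; last 3 first.
- by move=> u _; rewrite lee_fin addr_ge0// ltW.
- by move=> u _; rewrite mule_ge0// lee_fin ltW.
- exact: measurable_funeM.
rewrite [X in (X + _)%E]integral_cst//= probability_setT mule1.
rewrite ge0_integralZl//; last first.
  by rewrite lee_fin ltW.
rewrite integral_nneseries//.
apply: (@le_lt_trans _ _ ((L + r)%:E + L%:E * C%:E)%E); last first.
  by rewrite -EFinM -EFinD ltry.
rewrite leeD2l// lee_pmul2l//; apply: lime_le.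
  by apply: is_cvg_nneseries => k _ _; exact: integral_ge0.
apply: nearW => m; rewrite big_mkord.
have := sC m; rewrite -lee_fin -sumEFin; apply: le_trans.
apply: lee_sum => k _; rewrite integral_indic// setIT -prE//; exact: mS.
Qed.

End probability_reals.
Section isoperimetric_spaces.
Context {R : realType} {V : pmetricType R} (P : probability (borel V) R).
Implicit Types (A B : set V) (u v : V) (r s t : R).
Local Notation pr A := (fine (P A)).

Lemma extremal_pr t A : extremal_for P t A ->
  [/\ measurable (A : set (borel V)), t <= pr A &
    forall h B, 0 <= h -> measurable (B : set (borel V)) -> t <= pr B ->
      pr (enlargement A h) <= pr (enlargement B h)].
Proof.
move=> [mA tA Aopt]; split=> //; first by rewrite -lee_fin -prE.
move=> h B h0 mB tB; rewrite -lee_fin -!prE; try exact: measurable_enlargement.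
by apply: Aopt => //; rewrite (prE P mB) lee_fin.
Qed.

Lemma pr_neq0 t A : 0 < t -> t <= pr A -> A !=set0.
Proof.
move=> t0 tA; apply/set0P/negP => /eqP A0.
by move: tA; rewrite A0 measure0/= leNgt t0.
Qed.

Lemma extremal_neq0 t A : 0 < t -> extremal_for P t A -> A !=set0.
Proof. by move=> t0 /extremal_pr[_ tA _]; exact: pr_neq0 tA. Qed.

(** * Integrability of the metric *)

Section integrability.
Variable o : V.
Let cball r := [set u | mdist o u <= r].

Let mcball r : measurable (cball r : set (borel V)).
Proof. by apply: measurable_sublevel; exact: mdist_lipschitz. Qed.

Let mfar r : measurable ([set u | r < mdist o u] : set (borel V)).
Proof. by apply: measurable_suplevel; exact: mdist_lipschitz. Qed.

Let mfar_eq r : measurable ([set u | r <= mdist o u] : set (borel V)).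
Proof. by apply: measurable_suplevel_weak; exact: mdist_lipschitz. Qed.

Lemma large_ball : exists2 r, 0 < r & 1 / 2 < pr (cball r).
Proof.
apply: contrapT => small.
have le12 k : (P (cball k.+1%:R) <= (1 / 2)%:E)%E.
  rewrite prE// lee_fin leNgt; apply/negP => h; apply: small.
  by exists k.+1%:R.
have cupT : \bigcup_k (cball k.+1%:R) = [set: V].
  apply/seteqP; split => // u _; exists (Num.bound (mdist o u)) => //=.
  rewrite /cball/= (le_trans (ltW (archi_boundP _)))// ?mdist_ge0//.
  by rewrite ler_nat.
have : P \o (fun k => cball k.+1%:R) @ \oo --> P (\bigcup_k (cball k.+1%:R)).
  apply: nondecreasing_cvg_mu => //; first by rewrite cupT.
  move=> i j ij; apply/subsetPset => u; rewrite /cball/= => /le_trans; apply.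
  by rewrite ler_nat.
rewrite cupT probability_setT => c1.
have : (1 <= (1 / 2)%:E :> \bar R)%E.
  rewrite -(cvg_lim _ c1)//; apply: lime_le; first by apply: cvgP c1.
  by apply: nearW => k /=.
by rewrite lee_fin; lra.
Qed.

(** Extremality against a ball of radius [r] turns a bound on the complement of
    an enlargement into a bound on a tail of the metric. *)
Lemma far_le_extremal t A r s : 0 < r -> 0 <= s -> extremal_for P t A ->
  t <= pr (cball r) ->
  pr [set u | s + r < mdist o u] <= pr (~` enlargement A s).
Proof.
move=> r0 s0 /extremal_pr[_ _ Aopt] tr.
have mE := measurable_enlargement A s.
have := Aopt s _ s0 (mcball r) tr.
have : pr (enlargement (cball r) s) <= pr (~` [set u | s + r < mdist o u]).
  apply: pr_le; [exact: measurable_enlargement|exact: measurableC|].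
  have br0 : cball r !=set0 by exists o; rewrite /cball/= mdistxx ltW.
  rewrite enlargementE// => u /= us; apply/negP; rewrite -leNgt.
  have : mdist o u - r <= rdist (cball r) u; last by lra.
  apply: le_rdist => // b; rewrite /cball/= => br.
  by have := metric_triangle o b u; lra.
by rewrite !prC//; lra.
Qed.

(** The drop of the tail over an interval of length [2 * r] ending at [n] is at
    least the tail at [2 * n + r].  For [A] extremal for the measure of the event
    [F] of being at distance at least [n] from [o], the complement of the
    [2 * n]-enlargement of [A] lies at distance at least [n - 2 * r] from [o] and
    outside [A], which bounds its measure by the drop, while
    [far_le_extremal] bounds it below by the tail. *)
Lemma tail_decrement r (n : R) : isoperimetric P -> 0 < r -> 1 / 2 < pr (cball r) ->
  r < n -> (forall M, pr [set u | M < mdist o u] != 0) ->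
  pr [set u | 2 * n + r < mdist o u] <=
  pr [set u | n - 2 * r <= mdist o u] - pr [set u | n <= mdist o u].
Proof.
move=> iso r0 r12 rn unb; set F := [set u | n <= mdist o u]; set t := pr F.
have mF : measurable (F : set (borel V)) by exact: mfar_eq.
have tball : t <= 1 - pr (cball r).
  rewrite -prC//; apply: pr_le => //; first exact: measurableC.
  by move=> u; rewrite /F /cball/= => nu; apply/negP; rewrite -ltNge; lra.
have t0 : 0 < t.
  apply: (@lt_le_trans _ _ (pr [set u | n < mdist o u])).
    by rewrite lt_neqAle eq_sym unb pr_ge0.
  by apply: pr_le => // u /= /ltW.
have [|A extA] := iso t; first by apply/andP; split; lra.
have [mA tA Aopt] := extremal_pr extA.
have A0 := extremal_neq0 t0 extA.
have tball' : t <= pr (cball r) by lra.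
(* Otherwise some enlargement of [A] covers the ball of radius [r], whereas the
   same enlargement of [F] is still disjoint from this ball. *)
have Afar : A `<=` [set u | n - 2 * r <= mdist o u].
  move=> a Aa /=; rewrite leNgt; apply/negP => oa.
  pose h := mdist o a + r; have h0 : 0 <= h.
    by rewrite addr_ge0 ?mdist_ge0// ltW.
  have := Aopt h F h0 mF (lexx _); apply/negP; rewrite -ltNge.
  apply: (@le_lt_trans _ _ (pr (~` cball r))).
    apply: pr_le; [exact: measurable_enlargement|exact: measurableC|].
    move=> u; rewrite /enlargement/=; apply: contraPnot => ur.
    apply/negP; rewrite -ltNge; apply: (@lt_le_trans _ _ (n - r)%:E).
      by rewrite lte_fin /h; lra.
    apply: le_ereal_inf_tmp => _ [b nb <-]; rewrite lee_fin.
    have := metric_triangle o u b; rewrite (metric_sym u b).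
    by move: nb ur; rewrite /F /cball/=; lra.
  apply: (@lt_le_trans _ _ (pr (cball r))); first by rewrite prC//; lra.
  apply: pr_le => //; first exact: measurable_enlargement.
  move=> u; rewrite /cball/= => ur; apply: (enlargement_sub Aa).
  by have := metric_triangle a o u; rewrite (metric_sym a o) /h; lra.
have reach a s u : A a -> ~ enlargement A s u -> s - mdist o a < mdist o u.
  move=> Aa us; rewrite ltNge; apply/negP => ou; apply: us.
  apply: (enlargement_sub Aa).
  by have := metric_triangle a o u; rewrite (metric_sym a o); lra.
have subC s : 0 <= s -> ~` enlargement A s `<=` ~` A.
  move=> s0 u us Au; apply: us; apply: (enlargement_sub Au).
  by rewrite mdistxx.
(* Otherwise [A] is contained in [F] and fills it up to measure zero, so an
   enlargement of [A] reaching the ball of radius [n] has full measure; by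
   [far_le_extremal] the tail of the metric then vanishes somewhere. *)
have [a Aa an] : exists2 a, A a & mdist o a < n.
  apply: contrapT => noa; case: A0 => a0 Aa0.
  have AF : A `<=` F.
    by move=> a Aa; rewrite /F/= leNgt; apply/negP => an; apply: noa; exists a.
  pose s := mdist o a0 + n; have s0 : 0 <= s.
    by rewrite addr_ge0 ?mdist_ge0//; lra.
  have : pr (~` enlargement A s) <= pr (F `\` A).
    apply: pr_le; [|exact: measurableD|].
      exact: measurable_enlargementC.
    move=> u us; split; last exact: subC us.
    by have := reach _ _ _ Aa0 us; rewrite /F /s/=; lra.
  rewrite prD//; have := far_le_extremal r0 s0 extA tball' => h1 h2.
  have /negP := unb (s + r); apply.
  by rewrite eq_le pr_ge0 andbT; rewrite -/t in h2; lra.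
have n0 : 0 <= 2 * n by lra.
apply: (le_trans (far_le_extremal r0 n0 extA tball')).
apply: (@le_trans _ _ (pr ([set u | n - 2 * r <= mdist o u] `\` A))).
  apply: pr_le; [|exact: measurableD|].
    exact: measurable_enlargementC.
  move=> u us; split; last exact: subC us.
  by have := reach _ _ _ Aa us => /=; lra.
by rewrite prD//; lra.
Qed.

(** Either the metric is essentially bounded, or [tail_decrement] applies at
    [n = 2 * r * k.+1] for every [k] and the tails at [4 * r * k.+1 + r] have a
    telescoping majorant. *)
Lemma mdist_integrable : isoperimetric P ->
  P.-integrable [set: borel V] (EFin \o mdist o).
Proof.
move=> iso; have md : measurable_fun [set: borel V] (mdist o).
  by apply: lipschitz_measurable; exact: mdist_lipschitz.
have [[M M0]|unb] := pselect (exists M, pr [set u | M < mdist o u] = 0).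
  apply: (@integrable_sum_tail _ _ _ P _ 1 `|M| 0) => //.
    by move=> u; exact: mdist_ge0.
  move=> m; rewrite big1// => k _; apply/eqP; rewrite eq_le pr_ge0 andbT -M0.
  apply: pr_le => // u /=; rewrite mul1r; apply: le_lt_trans.
  by rewrite (le_trans (ler_norm M))// lerDr.
have [r r0 r12] := large_ball.
pose G n := pr [set u | n <= mdist o u].
apply: (@integrable_sum_tail _ _ _ P _ (2 * (2 * r)) r 1) => //.
- by move=> u; exact: mdist_ge0.
- by lra.
- by rewrite ltW.
move=> m; apply: (@le_trans _ _ (G 0 - G (2 * r * m%:R))); last first.
  have : G 0 <= 1 by exact: pr_le1.
  by have := pr_ge0 P [set u | 2 * r * m%:R <= mdist o u]; rewrite -/(G _); lra.
elim: m => [|m IH]; first by rewrite big_ord0 mulr0 subrr.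
rewrite big_ord_recr/=.
have := @tail_decrement r (2 * r * m.+1%:R) iso r0 r12.
have -> : 2 * r * m.+1%:R - 2 * r = 2 * r * m%:R.
  by rewrite -(natr1 m) mulrDr mulr1 addrK.
rewrite [2 * (2 * r * _)]mulrA -!/(G _) => dec.
suff : pr [set u | 2 * (2 * r) * m.+1%:R + r < mdist o u] <=
    G (2 * r * m%:R) - G (2 * r * m.+1%:R) by lra.
apply: dec; last by move=> M; apply/negP => /eqP M0; apply: unb; exists M.
have : 0 <= 2 * r * m%:R by rewrite mulr_ge0//; lra.
by rewrite -(natr1 m) mulrDr mulr1; lra.
Qed.

End integrability.

Lemma lipschitz_integrable (f : V -> R) : isoperimetric P -> lipschitz1 f ->
  P.-integrable [set: borel V] (EFin \o f).
Proof.
move=> iso lf.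
pose g u := `|f point| + mdist point u : R.
have ig : P.-integrable [set: borel V] (EFin \o g).
  have -> : EFin \o g = ((EFin \o cst `|f point|%R) \+ (EFin \o mdist point))%E by [].
  by apply: integrableD => //; [exact: finite_measure_integrable_cst|exact: mdist_integrable].
apply: (le_integrable _ _ _ ig) => //.
  by apply/measurable_EFinP; exact: lipschitz_measurable.
move=> u _ /=; rewrite lee_fin.
rewrite [leRHS]ger0_norm ?addr_ge0 ?mdist_ge0// /g.
have := ler_normD (f point) (f u - f point); rewrite subrKC.
by have := lf u point; rewrite (metric_sym u); lra.
Qed.

(** * Means of distances to extremal sets *)

Lemma tail_rdist A r : A !=set0 ->
  [set u | r < rdist A u] = ~` enlargement A r.
Proof.
move=> A0; rewrite enlargementE//.
by apply/seteqP; split => u /=; rewrite ltNge => /negP.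
Qed.

Lemma measurable_rdist A : A !=set0 -> measurable_fun [set: borel V] (rdist A).
Proof. by move=> A0; apply: lipschitz_measurable; exact: rdist_lipschitz. Qed.

Lemma extremal_tail_ge t A B r : 0 < t -> 0 <= r -> extremal_for P t A ->
  measurable (B : set (borel V)) -> t <= pr B ->
  (P [set u | (r < rdist B u)%R] <= P [set u | (r < rdist A u)%R])%E.
Proof.
move=> t0 r0 extA mB tB; have A0 := extremal_neq0 t0 extA.
have B0 := pr_neq0 t0 tB.
have [_ _ Aopt] := extremal_pr extA.
have mEC C := @measurable_enlargementC R V C r.
rewrite !tail_rdist// (prE P (mEC A)) (prE P (mEC B)) lee_fin.
have := Aopt r B r0 mB tB; rewrite !prC; try exact: measurable_enlargement.
lra.
Qed.

Lemma extremal_mean_ge t A B : 0 < t -> extremal_for P t A ->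
  measurable (B : set (borel V)) -> t <= pr B ->
  (\int[P]_u (rdist B u)%:E <= \int[P]_u (rdist A u)%:E)%E.
Proof.
move=> t0 extA mB tB.
have A0 := extremal_neq0 t0 extA.
have B0 := pr_neq0 t0 tB.
apply: (@le_integral_tail _ _ _ P (rdist B) (rdist A)).
- exact: measurable_rdist.
- exact: measurable_rdist.
- by move=> u; exact: rdist_ge0.
- by move=> u; exact: rdist_ge0.
- by move=> r r0; exact: (extremal_tail_ge t0 r0 extA mB tB).
Qed.

(** Left continuity in [t] of the extremal enlargements, up to the loss from [r]
    to [r'].  With [h] strictly between [r'] and [r], taking the complement of an
    enlargement twice, from [B n] by [r] and then from a set [C] extremal for [s]
    by [h], leads back to a set of measure at least [T] against which [A] can be
    compared. *)
Lemma extremal_tail_lim (T : R) A (a : nat -> R) (B : nat -> set V) r r' s :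
  isoperimetric P -> extremal_for P T A ->
  (forall n, measurable (B n : set (borel V))) -> (forall n : nat, a n <= pr (B n)) ->
  (forall M, (forall n, a n <= M) -> T <= M) ->
  0 <= r' -> r' < r -> (forall n, s <= pr (~` enlargement (B n) r)) ->
  s <= pr (~` enlargement A r').
Proof.
move=> iso /extremal_pr[mA TA Aopt] mB aB aT r'0 r'r sB.
have mE := @measurable_enlargement R V.
have mEC := @measurable_enlargementC R V.
have [s0|/ltW s0] := leP s 0; first by rewrite (le_trans s0)// pr_ge0.
have [|C /extremal_pr[mC sC Copt]] := iso s.
  by rewrite s0 (le_trans (sB 0%N))// pr_le1.
pose h := (r + r') / 2.
have [h0 hr r'h] : [/\ 0 <= h, h < r & r' < h] by rewrite /h; split; lra.
have TC : T <= pr (~` enlargement C h).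
  rewrite prC//; apply: aT => n.
  have : pr (enlargement (~` enlargement (B n) r) h) <= pr (~` B n).
    by apply: pr_le => //; [exact: measurableC|exact: enlargement_setC].
  by have := Copt _ _ h0 (mEC (B n) r) (sB n); have := aB n; rewrite prC//; lra.
have : pr (enlargement (~` enlargement C h) r') <= pr (~` C).
  by apply: pr_le => //; [exact: measurableC|exact: enlargement_setC].
by have := Aopt _ _ r'0 (mEC C h) TC; rewrite !prC//; lra.
Qed.

(** Along levels [a n] increasing to [T], the means for extremal sets [B n] stay at
    least [x].  The loss from [r] to [r'] in [extremal_tail_lim] is absorbed by
    comparing with [rdist A + e] for arbitrarily small [e], since the tail of
    [rdist A + e] at [r] is the tail of [rdist A] at [r - e]. *)
Lemma extremal_mean_lim (T x : R) A : isoperimetric P -> 0 < T -> T <= 1 ->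
  extremal_for P T A ->
  (forall t, 0 < t < T -> exists B, [/\ measurable (B : set (borel V)),
     t <= pr B & (x%:E <= \int[P]_u (rdist B u)%:E)%E]) ->
  (x%:E <= \int[P]_u (rdist A u)%:E)%E.
Proof.
move=> iso T0 T1 extA approx; have A0 := extremal_neq0 T0 extA.
pose a (n : nat) : R := T * (1 - n.+2%:R^-1).
have a01 n : 0 < (n.+2%:R^-1 : R) < 1.
  by rewrite invr_gt0 ltr0n invf_lt1 ?ltr0n// ltr1n.
have a0 n : 0 < a n by rewrite mulr_gt0// subr_gt0; case/andP: (a01 n).
have aT n : a n < T by rewrite gtr_pMr// gtrBl; case/andP: (a01 n).
have aS n : a n <= a n.+1.
  by rewrite ler_pM2l// lerD2l lerN2 lef_pV2 ?posrE// ler_nat.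
have alim M : (forall n, a n <= M) -> T <= M.
  move=> aM; rewrite leNgt; apply/negP => MT.
  have e0 : 0 < (T - M) / T by rewrite divr_gt0// subr_gt0.
  have := aM (Num.bound ((T - M) / T)^-1); apply/negP; rewrite -ltNge.
  set n := Num.bound _.
  have : n.+2%:R^-1 < (T - M) / T.
    rewrite -[ltRHS]invrK ltf_pV2 ?posrE ?invr_gt0//.
    apply: (lt_le_trans (archi_boundP _)); first by rewrite invr_ge0 ltW.
    by rewrite ler_nat -addn2 leq_addr.
  by rewrite ltr_pdivlMr// /a mulrBr mulr1 (mulrC T) ltrBrDl ltrBrDr.
have /choice[B extB] n : exists B, extremal_for P (a n) B.
  by apply: iso; rewrite ltW//= (le_trans (ltW (aT n))).
have B0 n := extremal_neq0 (a0 n) (extB n).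
have mB n : measurable (B n : set (borel V)) by have [] := extB n.
have aB n : a n <= pr (B n) by have [] := extremal_pr (extB n).
have iA C : C !=set0 -> P.-integrable [set: borel V] (EFin \o rdist C).
  by move=> C0; apply: lipschitz_integrable => //; exact: rdist_lipschitz.
have mE := @measurable_enlargement R V.
have mEC := @measurable_enlargementC R V.
apply/lee_addgt0Pr => e e0.
have -> : (\int[P]_u (rdist A u)%:E + e%:E = \int[P]_u (rdist A u + e)%:E)%E.
  under [in RHS]eq_integral do rewrite EFinD.
  rewrite integralD//; [|exact: iA|exact: finite_measure_integrable_cst].
  by rewrite [X in _ = (_ + X)%E]integral_cst//= probability_setT mule1.
apply: (@ge_integral_tail_lim _ _ _ P (fun n => rdist (B n))).
- by move=> n; exact: measurable_rdist.
- by apply: measurable_funD => //; exact: measurable_rdist.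
- by move=> n u; exact: rdist_ge0.
- by move=> u; rewrite addr_ge0 ?rdist_ge0// ltW.
- have /integrableP[_] := iA _ (B0 0%N).
  by under eq_integral do rewrite /= ger0_norm ?rdist_ge0//.
- move=> n r r0; apply: (extremal_tail_ge (a0 n)) => //.
  exact: (le_trans (aS n)).
- move=> s r r0; case: s => [s| |].
  + move=> sB; have [re|er] := ltP r e.
      rewrite (_ : [set _ | _] = setT); last first.
        by apply/seteqP; split => // u _ /=; have := rdist_ge0 A u; lra.
      rewrite probability_setT; apply: (le_trans (sB 0%N)).
      by apply: probability_le1; rewrite tail_rdist.
    rewrite (_ : [set _ | _] = [set u | r - e < rdist A u]); last first.
      by apply/seteqP; split => u /=; lra.
    rewrite tail_rdist// prE// lee_fin.
    apply: (extremal_tail_lim iso extA mB aB alim (r := r)); [lra|lra|].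
    by move=> n; have := sB n; rewrite tail_rdist// prE// lee_fin.
  + move=> /(_ 0%N); rewrite tail_rdist// prE// leye_eq; by [].
  + by rewrite leNye.
move=> n; have [|C [mC tC xC]] := approx (a n); first by rewrite a0 aT.
exact: (le_trans xC (extremal_mean_ge (a0 n) (extB n) mC tC)).
Qed.

(** Since [f >= E f + x] on [B] and [f] is 1-Lipschitz, [f + rdist B >= E f + x]
    everywhere; the bound is the mean of this inequality. *)
Lemma superlevel_mean (f : V -> R) x (B := [set u | x <= f u - fine (\int[P]_v (f v)%:E)]) :
  isoperimetric P -> lipschitz1 f -> B !=set0 ->
  (x%:E <= \int[P]_u (rdist B u)%:E)%E.
Proof.
move=> iso lf B0; set m := fine _ in B B0 *.
have intf := lipschitz_integrable iso lf.
have intB := lipschitz_integrable iso (rdist_lipschitz B0).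
have fE : (\int[P]_v (f v)%:E = m%:E)%E.
  by rewrite fineK//; exact: integrable_fin_num intf.
have fB u : m + x <= f u + rdist B u.
  rewrite -lerBlDl; apply: le_rdist => // b.
  rewrite /B/= => xb; have := lf b u; rewrite ler_norml => /andP[h1 h2]; lra.
rewrite -(leeD2lE _ _ (isT : m%:E \is a fin_num)) -EFinD -[in leRHS]fE.
rewrite -integralD//.
have -> : (m + x)%:E = (\int[P]_u (m + x)%:E)%E.
  by rewrite integral_cst//= probability_setT mule1.
apply: le_integral => //.
- exact: finite_measure_integrable_cst.
- exact: integrableD.
- by move=> u _; rewrite -EFinD lee_fin.
Qed.

End isoperimetric_spaces.

Theorem theorem2 (R : realType) (V : pmetricType R)
    (P : probability (borel V) R) :
  isoperimetric P ->
  forall x : R, exists A : set V,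
    [/\ extremal P A,
        sup_deviation P x = deviation P (fun u : V => (- setdist A u)%E) x &
        P A = sup_deviation P x].
Proof.
move=> iso x.
have devE (f : V -> R) : lipschitz1 f -> deviation P (EFin \o f) x =
    P [set u | x <= f u - fine (\int[P]_v (f v)%:E)].
  move=> lf; rewrite /deviation; congr (P _); apply/funext => u /=.
  rewrite -[X in (_ - X)%E]fineK; first by rewrite -EFinB lee_fin.
  exact: (integrable_fin_num measurableT (lipschitz_integrable iso lf)).
have mdev (f : V -> R) : lipschitz1 f ->
    measurable ([set u | x <= f u - fine (\int[P]_v (f v)%:E)] : set (borel V)).
  move=> lf; apply: measurable_suplevel_weak => u v.
  by rewrite opprB addrA subrK lf.
have sup0 : (0 <= sup_deviation P x)%E.
  apply: (@le_trans _ _ (deviation P (EFin \o cst 0) x)); first exact: measure_ge0.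
  have l0 : lipschitz1 (cst 0 : V -> R).
    by move=> u v; rewrite subrr normr0 mdist_ge0.
  apply: ereal_sup_ubound; exists (cst 0) => //; split => //.
  exact: lipschitz_integrable.
have sup1 : (sup_deviation P x <= 1)%E.
  apply: ge_ereal_sup => _ [f [_ lf] <-]; rewrite devE//.
  by apply: probability_le1; exact: mdev.
have [D0|Dneq0] := eqVneq (sup_deviation P x) 0%E.
  exists set0; split; [|rewrite D0; symmetry|by rewrite measure0 D0].
    exists 0; first by rewrite lexx ler01.
    split => // h B h0 mB _.
    by rewrite enlargement0 measure0 measure_ge0.
  have f0 : (fun u : V => - setdist set0 u)%E = cst -oo%E.
    by apply/funext => u; rewrite /setdist image_set0 ereal_inf0.
  rewrite /deviation f0 integral_cst//= probability_setT mule1.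
  rewrite (_ : [set _ | _] = set0) ?measure0//; apply/seteqP; split => // u /=.
  by rewrite /setdist image_set0 ereal_inf0.
pose T := fine (sup_deviation P x).
have DT : sup_deviation P x = T%:E.
  by rewrite fineK// ge0_fin_numE// (le_lt_trans sup1)// ltry.
have T0 : 0 < T by rewrite -lte_fin -DT lt_neqAle eq_sym Dneq0.
have T1 : T <= 1 by rewrite -lee_fin -DT.
have [|A extA] := iso T; first by rewrite ltW.
have A0 := extremal_neq0 T0 extA.
have [mA TA _] := extA.
have ltA := rdist_lipschitz A0.
have lNA : lipschitz1 (fun u => - rdist A u).
  by move=> u v; rewrite -opprD normrN.
have xA : (x%:E <= \int[P]_u (rdist A u)%:E)%E.
  apply: (extremal_mean_lim iso T0 T1 extA) => t /andP[t0 tT].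
  have : (t%:E < sup_deviation P x)%E by rewrite DT lte_fin.
  move=> /ereal_sup_gt[_ [f [_ lf] <-]]; rewrite devE// => /ltW tf.
  have mB := mdev f lf.
  exists [set u | x <= f u - fine (\int[P]_v (f v)%:E)]; split => //.
    by rewrite -lee_fin -prE.
  apply: superlevel_mean => //; apply: (pr_neq0 t0).
  by rewrite -lee_fin -prE; [exact: tf|exact: mB].
have devA : deviation P (fun u : V => (- setdist A u)%E) x =
    deviation P (EFin \o (fun u => - rdist A u)) x.
  congr deviation; apply/funext => u /=; case: A0 => a Aa.
  by rewrite (setdistE u Aa) EFinN.
have le1 : (P A <= deviation P (fun u : V => (- setdist A u)%E) x)%E.
  rewrite devA devE//; apply: le_measure; rewrite ?inE//; first exact: mdev.
  move=> u Au /=; rewrite rdist0// oppr0 sub0r.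
  have -> : (\int[P]_v (- rdist A v)%:E = - \int[P]_v (rdist A v)%:E)%E.
    under eq_integral do rewrite EFinN.
    by rewrite integral_ge0N// => v _; rewrite lee_fin rdist_ge0.
  rewrite fineN opprK -lee_fin fineK//.
  exact: (integrable_fin_num measurableT (lipschitz_integrable iso ltA)).
have le2 : (deviation P (fun u : V => (- setdist A u)%E) x <= sup_deviation P x)%E.
  rewrite devA; apply: ereal_sup_ubound; exists (fun u => - rdist A u) => //.
  by split => //; exact: lipschitz_integrable.
exists A; split; first by exists T => //; rewrite ltW.
- by apply/eqP; rewrite eq_le le2 andbT DT (le_trans TA).
- by apply/eqP; rewrite eq_le (le_trans le1 le2) DT.
Qed.
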